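(* Let $R$ be a quasi-normal ring and let $I$ be an ideal of $R$ of grade at least $2$ on $R$. Let $M$ be a (finitely generated) reflexive $R$-module having $R$ as a direct summand, and assume that $\operatorname{gldim} \operatorname{End}_R (M \oplus I)$ is finite. Then $\operatorname{gldim} \operatorname{End}_R(M)$ is also finite.
   Context: A commutative noetherian ring $R$ is quasi-normal if it is Gorenstein in codimension one (i.e. $R_{\mathfrak p}$ is Gorenstein for every prime $\mathfrak p$ of height at most one) and satisfies condition $(S_2)$, i.e. $\operatorname{depth}(R_\mathfrak{p}) \geq \min\{ 2, \dim R_\mathfrak{p} \}$ for every prime ideal $\mathfrak{p}$ of $R$. *)

(* Defs.v *)
From HB Require Import structures.
From mathcomp Require Import all_boot all_algebra.
From mathcomp Require Import generic_quotient boolp ring.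

Set Implicit Arguments.
Unset Strict Implicit.
Unset Printing Implicit Defensive.

Import GRing.Theory.
Local Open Scope ring_scope.
Local Open Scope quotient_scope.

(* The "pz" ring structures of MathComp include the zero ring.  Modules over
   a noncommutative ring are left modules, and a product [f * g] of
   endomorphisms is the composite [f \o g], so M is a left End_R(M)-module. *)

Definition hom (R : pzRingType) (M N : lmodType R) : Type := {linear M -> N}.

Section HomZmod.
Variables (R : pzRingType) (M N : lmodType R).
Implicit Types f g h : hom M N.

HB.instance Definition _ := gen_eqMixin (hom M N).
HB.instance Definition _ := gen_choiceMixin (hom M N).

Lemma hom_ext f g : f =1 g -> f = g.
Proof.
case: f g => [f [[cf1] [cf2]]] [g [[cg1] [cg2]]] /= fg.
have efg : f = g by apply/funext.
subst g.
by rewrite (Prop_irrelevance cf1 cg1) (Prop_irrelevance cf2 cg2).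
Qed.

Definition hom_zero : hom M N := (\0 : {linear M -> N}).
Definition hom_opp f : hom M N := (\- f : {linear M -> N}).
Definition hom_add f g : hom M N := (f \+ g : {linear M -> N}).

Lemma hom_addA : associative hom_add.
Proof. by move=> f g h; apply: hom_ext => x /=; rewrite addrA. Qed.

Lemma hom_addC : commutative hom_add.
Proof. by move=> f g; apply: hom_ext => x /=; rewrite addrC. Qed.

Lemma hom_add0 : left_id hom_zero hom_add.
Proof. by move=> f; apply: hom_ext => x /=; rewrite add0r. Qed.

Lemma hom_addN : left_inverse hom_zero hom_opp hom_add.
Proof. by move=> f; apply: hom_ext => x /=; rewrite addNr. Qed.

HB.instance Definition _ :=
  GRing.isZmodule.Build (hom M N) hom_addA hom_addC hom_add0 hom_addN.

End HomZmod.

Section HomLmod.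
Variables (R : comPzRingType) (M N : lmodType R).
Implicit Types f g : hom M N.

Definition hom_scale (a : R) f : hom M N := (a \*: f : {linear M -> N}).

Lemma hom_scaleA a b f : hom_scale a (hom_scale b f) = hom_scale (a * b) f.
Proof. by apply: hom_ext => x /=; rewrite scalerA. Qed.

Lemma hom_scale1 : left_id 1 hom_scale.
Proof. by move=> f; apply: hom_ext => x /=; rewrite scale1r. Qed.

Lemma hom_scaleDr : right_distributive hom_scale +%R.
Proof. by move=> a f g; apply: hom_ext => x /=; rewrite scalerDr. Qed.

Lemma hom_scaleDl f : {morph hom_scale^~ f : a b / a + b}.
Proof. by move=> a b; apply: hom_ext => x /=; rewrite scalerDl. Qed.

HB.instance Definition _ :=
  GRing.Zmodule_isLmodule.Build R (hom M N)
    hom_scaleA hom_scale1 hom_scaleDr hom_scaleDl.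

End HomLmod.

Definition endo (R : pzRingType) (M : lmodType R) : Type := hom M M.

Section EndoRing.
Variables (R : pzRingType) (M : lmodType R).

HB.instance Definition _ := GRing.Zmodule.on (endo M).

Definition endo_one : endo M := (idfun : {linear M -> M}).
Definition endo_mul (f g : endo M) : endo M := (f \o g : {linear M -> M}).

Lemma endo_mulA : associative endo_mul.
Proof. by move=> f g h; apply: hom_ext. Qed.

Lemma endo_mul1 : left_id endo_one endo_mul.
Proof. by move=> f; apply: hom_ext. Qed.

Lemma endo_1mul : right_id endo_one endo_mul.
Proof. by move=> f; apply: hom_ext. Qed.

Lemma endo_mulDl : left_distributive endo_mul +%R.
Proof. by move=> f g h; apply: hom_ext. Qed.

Lemma endo_mulDr : right_distributive endo_mul +%R.
Proof. by move=> f g h; apply: hom_ext => x /=; rewrite linearD. Qed.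

HB.instance Definition _ :=
  GRing.Zmodule_isPzRing.Build (endo M)
    endo_mulA endo_mul1 endo_1mul endo_mulDl endo_mulDr.

End EndoRing.

Section Submodule.
Variables (R : pzRingType) (V : lmodType R) (S : submodClosed V).

Definition submod : Type := {x : V | x \in S}.

HB.instance Definition _ := SubType.on submod.
HB.instance Definition _ := Choice.on submod.
HB.instance Definition _ := [SubChoice_isSubLmodule of submod by <:].

End Submodule.

Definition fin_gen (R : pzRingType) (M : lmodType R) : Prop :=
  exists (n : nat) (g : 'I_n -> M),
    forall x, exists c : 'I_n -> R, x = \sum_(i < n) c i *: g i.

Definition has_ring_summand (R : pzRingType) (M : lmodType R) : Prop :=
  exists (N : lmodType R) (f : {linear M -> (R^o * N)%type}), bijective f.

Section Reflexive.
Variables (R : comPzRingType) (M : lmodType R).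

Definition dual (N : lmodType R) : lmodType R := hom N R^o.

Definition eval_fun (x : M) (phi : dual M) : R^o :=
  (phi : {linear M -> R^o}) x.

Lemma eval_fun_linear x : linear (eval_fun x).
Proof. by []. Qed.

HB.instance Definition _ x :=
  GRing.isLinear.Build R (dual M) R^o *:%R (eval_fun x) (eval_fun_linear x).

Definition bidual_map (x : M) : dual (dual M) :=
  (eval_fun x : {linear dual M -> R^o}).

Definition reflexive_module : Prop := bijective bidual_map.

End Reflexive.

Section HomologicalDimension.
Variable A : pzRingType.

Definition projective (P : lmodType A) : Prop :=
  forall (N Q : lmodType A) (g : {linear N -> Q}) (f : {linear P -> Q}),
    (forall y, exists x, g x = y) ->
    exists h : {linear P -> N}, forall x, g (h x) = f x.

Definition injective_module (E : lmodType A) : Prop :=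
  forall (N Q : lmodType A) (g : {linear N -> Q}) (f : {linear N -> E}),
    injective g ->
    exists h : {linear Q -> E}, forall x, h (g x) = f x.

(* A projective resolution  0 -> P_n -> ... -> P_0 -> M -> 0. *)
Definition projdim_le (M : lmodType A) (n : nat) : Prop :=
  exists (P : nat -> lmodType A) (d : forall i, {linear P i.+1 -> P i})
         (e : {linear P 0 -> M}),
    [/\ forall i, projective (P i),
        forall y, exists x, e x = y,
        forall x, e x = 0 <-> exists z, d 0 z = x,
        forall i x, d i x = 0 <-> exists z, d i.+1 z = x &
        forall i, (n < i)%N -> forall x : P i, x = 0].

(* An injective resolution  0 -> M -> E_0 -> ... -> E_n -> 0. *)
Definition injdim_le (M : lmodType A) (n : nat) : Prop :=
  exists (E : nat -> lmodType A) (d : forall i, {linear E i -> E i.+1})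
         (e : {linear M -> E 0}),
    [/\ forall i, injective_module (E i),
        injective e,
        forall x, d 0 x = 0 <-> exists z, e z = x,
        forall i x, d i.+1 x = 0 <-> exists z, d i z = x &
        forall i, (n < i)%N -> forall x : E i, x = 0].

(* Left global dimension; left and right global dimension agree for rings that
   are noetherian on both sides, such as End_R(M) for M finitely generated over
   a commutative noetherian ring R. *)
Definition finite_gldim : Prop :=
  exists n, forall M : lmodType A, projdim_le M n.

End HomologicalDimension.

Definition ideal (R : comPzRingType) : Type := submodClosed (R^o : lmodType R).

Definition noetherian (R : comPzRingType) : Prop :=
  forall I : ideal R, fin_gen (submod I).

Record prime_ideal (R : comPzRingType) := PrimeIdeal {
  prime_ideal_val :> submodClosed (R^o : lmodType R);
  prime_ideal_proper : (1 : R) \notin prime_ideal_val;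
  prime_ideal_mul : forall x y : R,
    x * y \in prime_ideal_val -> (x \in prime_ideal_val) || (y \in prime_ideal_val) }.

Section DimensionDepth.
Variable R : comPzRingType.

(* A strictly increasing chain P 0 < ... < P n of prime ideals. *)
Definition prime_chain (n : nat) (P : nat -> prime_ideal R) : Prop :=
  forall i, (i < n)%N ->
    {subset P i <= P i.+1} /\ exists2 x, x \in P i.+1 & x \notin P i.

Definition height_le (p : prime_ideal R) (n : nat) : Prop :=
  forall (k : nat) (P : nat -> prime_ideal R),
    prime_chain k P -> P k =i p -> (k <= n)%N.

Definition krulldim_ge (n : nat) : Prop := exists P, prime_chain n P.

Definition ideal_span (s : seq R) (x : R) : Prop :=
  exists c : nat -> R, x = \sum_(i < size s) c i * s`_i.

Definition regular_sequence (s : seq R) : Prop :=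
  (forall i x, (i < size s)%N ->
     ideal_span (take i s) (s`_i * x) -> ideal_span (take i s) x)
  /\ ~ ideal_span s 1.

(* grade(I, R) >= n; by convention the grade of the unit ideal is infinite. *)
Definition grade_ge (I : ideal R) (n : nat) : Prop :=
  (1 : R) \in I \/
  exists s : seq R, [/\ size s = n, {subset s <= I} & regular_sequence s].

(* depth R >= n for R local, whose maximal ideal is the set of nonunits. *)
Definition depth_ge (n : nat) : Prop :=
  exists s : seq R,
    [/\ size s = n, forall x, x \in s -> ~ (exists y, x * y = 1)
      & regular_sequence s].

(* A noetherian local ring is Gorenstein if it has finite injective dimension
   as a module over itself. *)
Definition gorenstein_local : Prop := exists n, injdim_le (R^o : lmodType R) n.

End DimensionDepth.

Section Localization.
Variables (R : comPzRingType) (p : prime_ideal R).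

Record fracs := Fracs { frac_pair :> R * R; _ : frac_pair.2 \notin p }.

HB.instance Definition _ := [isSub for frac_pair].
HB.instance Definition _ := [Choice of fracs by <:].

Implicit Types x y z : fracs.

Lemma notin_mul (s t : R) : s \notin p -> t \notin p -> s * t \notin p.
Proof.
by move=> sp tp; apply/negP => /prime_ideal_mul; rewrite (negPf sp) (negPf tp).
Qed.

Lemma den_notin x : x.2 \notin p. Proof. by case: x. Qed.

Definition loc_equiv x y : bool :=
  `[< exists2 t : R, t \notin p & t * (x.1 * y.2) = t * (y.1 * x.2) >].

Lemma loc_equiv_refl : reflexive loc_equiv.
Proof.
by move=> x; apply/asboolP; exists 1 => //; exact: prime_ideal_proper.
Qed.

Lemma loc_equiv_sym : symmetric loc_equiv.
Proof.
by move=> x y; apply/asboolP/asboolP => -[t tp e]; exists t.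
Qed.

Lemma loc_equiv_trans : transitive loc_equiv.
Proof.
move=> y x z /asboolP[t tp exy] /asboolP[u up eyz]; apply/asboolP.
exists (t * u * y.2); first by rewrite !notin_mul ?den_notin.
have -> : t * u * y.2 * (x.1 * z.2) = u * z.2 * (t * (x.1 * y.2)) by ring.
have -> : t * u * y.2 * (z.1 * x.2) = t * x.2 * (u * (z.1 * y.2)) by ring.
by rewrite exy -eyz; ring.
Qed.

Canonical loc_equiv_equiv :=
  EquivRel loc_equiv loc_equiv_refl loc_equiv_sym loc_equiv_trans.

Definition localization : Type := {eq_quot loc_equiv}.

HB.instance Definition _ : EqQuotient _ loc_equiv localization :=
  EqQuotient.on localization.
HB.instance Definition _ := Choice.on localization.

Lemma loc_eqP x y :
  reflect (exists2 t : R, t \notin p & t * (x.1 * y.2) = t * (y.1 * x.2))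
          (x == y %[mod localization]).
Proof. by rewrite eqmodE; exact: asboolP. Qed.

Definition frac_of (a : R) : fracs := @Fracs (a, 1) (prime_ideal_proper p).
Definition frac_add x y : fracs :=
  @Fracs (x.1 * y.2 + y.1 * x.2, x.2 * y.2)
         (notin_mul (den_notin x) (den_notin y)).
Definition frac_opp x : fracs := @Fracs (- x.1, x.2) (den_notin x).
Definition frac_mul x y : fracs :=
  @Fracs (x.1 * y.1, x.2 * y.2) (notin_mul (den_notin x) (den_notin y)).

Definition loc_of := lift_embed localization frac_of.
Canonical loc_of_pi_morph := PiEmbed loc_of.

Definition loc_add := lift_op2 localization frac_add.
Definition loc_opp := lift_op1 localization frac_opp.
Definition loc_mul := lift_op2 localization frac_mul.

Lemma repr_equiv x : exists2 t : R, t \notin p &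
  t * ((repr (\pi_localization x)).1 * x.2)
  = t * (x.1 * (repr (\pi_localization x)).2).
Proof. by apply/loc_eqP; rewrite reprK. Qed.

Lemma pi_loc_add : {morph \pi : x y / frac_add x y >-> loc_add x y}.
Proof.
move=> x y; unlock loc_add; apply/eqP/loc_eqP => /=.
have [t tp et] := repr_equiv x; have [u up eu] := repr_equiv y.
move: (repr _) et (repr _) eu => x' et y' eu.
exists (t * u); first exact: notin_mul.
transitivity (u * y.2 * y'.2 * (t * (x.1 * x'.2))
            + t * x.2 * x'.2 * (u * (y.1 * y'.2))); first by ring.
by rewrite -et -eu; ring.
Qed.
Canonical pi_loc_add_morph := PiMorph2 pi_loc_add.

Lemma pi_loc_opp : {morph \pi : x / frac_opp x >-> loc_opp x}.
Proof.
move=> x; unlock loc_opp; apply/eqP/loc_eqP => /=.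
have [t tp et] := repr_equiv x; exists t => //.
by rewrite !mulNr !mulrN et.
Qed.
Canonical pi_loc_opp_morph := PiMorph1 pi_loc_opp.

Lemma pi_loc_mul : {morph \pi : x y / frac_mul x y >-> loc_mul x y}.
Proof.
move=> x y; unlock loc_mul; apply/eqP/loc_eqP => /=.
have [t tp et] := repr_equiv x; have [u up eu] := repr_equiv y.
move: (repr _) et (repr _) eu => x' et y' eu.
exists (t * u); first exact: notin_mul.
transitivity ((t * (x.1 * x'.2)) * (u * (y.1 * y'.2))); first by ring.
by rewrite -et -eu; ring.
Qed.
Canonical pi_loc_mul_morph := PiMorph2 pi_loc_mul.

Lemma loc_eq1 x y : x.1 * y.2 = y.1 * x.2 -> x = y %[mod localization].
Proof.
move=> e; apply/eqP/loc_eqP; exists 1; last by rewrite e.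
exact: prime_ideal_proper.
Qed.

Lemma loc_addA : associative loc_add.
Proof.
elim/quotW=> x; elim/quotW=> y; elim/quotW=> z; rewrite !piE.
by apply: loc_eq1 => /=; ring.
Qed.

Lemma loc_addC : commutative loc_add.
Proof.
elim/quotW=> x; elim/quotW=> y; rewrite !piE.
by apply: loc_eq1 => /=; ring.
Qed.

Lemma loc_add0 : left_id (loc_of 0) loc_add.
Proof. by elim/quotW=> x; rewrite !piE; apply: loc_eq1 => /=; ring. Qed.

Lemma loc_addN : left_inverse (loc_of 0) loc_opp loc_add.
Proof. by elim/quotW=> x; rewrite !piE; apply: loc_eq1 => /=; ring. Qed.

HB.instance Definition _ :=
  GRing.isZmodule.Build localization loc_addA loc_addC loc_add0 loc_addN.

Lemma loc_mulA : associative loc_mul.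
Proof.
elim/quotW=> x; elim/quotW=> y; elim/quotW=> z; rewrite !piE.
by apply: loc_eq1 => /=; ring.
Qed.

Lemma loc_mulC : commutative loc_mul.
Proof.
elim/quotW=> x; elim/quotW=> y; rewrite !piE.
by apply: loc_eq1 => /=; ring.
Qed.

Lemma loc_mul1 : left_id (loc_of 1) loc_mul.
Proof. by elim/quotW=> x; rewrite !piE; apply: loc_eq1 => /=; ring. Qed.

Lemma loc_mulDl : left_distributive loc_mul loc_add.
Proof.
elim/quotW=> x; elim/quotW=> y; elim/quotW=> z; rewrite !piE.
by apply: loc_eq1 => /=; ring.
Qed.

HB.instance Definition _ :=
  GRing.Zmodule_isComPzRing.Build localization
    loc_mulA loc_mulC loc_mul1 loc_mulDl.

End Localization.

Definition gorenstein_in_codim1 (R : comPzRingType) : Prop :=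
  forall p : prime_ideal R, height_le p 1 -> gorenstein_local (localization p).

(* depth R_p >= min(2, dim R_p), written as depth R_p >= min(2, k) for every
   k <= dim R_p, so that no value has to be assigned to an infinite dim. *)
Definition serre_S2 (R : comPzRingType) : Prop :=
  forall (p : prime_ideal R) (k : nat),
    krulldim_ge (localization p) k -> depth_ge (localization p) (minn 2 k).

Definition quasi_normal (R : comPzRingType) : Prop :=
  [/\ noetherian R, gorenstein_in_codim1 R & serre_S2 R].

(* Main.v *)
(* Write A = End(M), E = End(M + I) and e in E for the projection onto M.  Since
   grade I >= 2 and M is reflexive, every map I -> M is multiplication by a
   unique element of M; as R is a summand of M, this makes the left A-module
   P = Hom(M + I, M) = eE projective.  The exact functor X |-> eX from E-modules
   to A-modules has the right adjoint Hom_A(P, -), which is exact, so X |-> eX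
   preserves projectives; and e Hom_A(P, N) = N.  Hence e applied to an
   E-projective resolution of Hom_A(P, N) is an A-projective resolution of N, and
   gldim A <= gldim E. *)
From HB Require Import structures.
From mathcomp Require Import all_boot all_algebra.
From mathcomp Require Import boolp.
Require Import Defs.

Set Implicit Arguments.
Unset Strict Implicit.
Unset Printing Implicit Defensive.

Import GRing.Theory.
Local Open Scope ring_scope.

Definition to_linear (A : pzRingType) (X Y : lmodType A) (f : X -> Y)
    (f_lin : linear f) : {linear X -> Y} :=
  HB.pack_for {linear X -> Y} f (GRing.isLinear.Build A X Y *:%R f f_lin).

(* An alias of [hom], which already carries an [R]-module structure when [R] is
   commutative. *)
Definition post_hom (R : pzRingType) (U V : lmodType R) : Type := hom U V.

(** * The [endo V]-module Hom(U, V) and the [endo U]-modules coinduced along it *)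

Section PostHom.
Variables (R : pzRingType) (U V : lmodType R).

HB.instance Definition _ := GRing.Zmodule.on (post_hom U V).

Definition post_scale (a : endo V) (u : post_hom U V) : post_hom U V :=
  ((a : {linear V -> V}) \o (u : {linear U -> V}) : {linear U -> V}).

Lemma post_scaleA a b u : post_scale a (post_scale b u) = post_scale (a * b) u.
Proof. exact: hom_ext. Qed.

Lemma post_scale1 : left_id 1 post_scale.
Proof. by move=> u; apply: hom_ext. Qed.

Lemma post_scaleDr : right_distributive post_scale +%R.
Proof. by move=> a u v; apply: hom_ext => x /=; rewrite linearD. Qed.

Lemma post_scaleDl u : {morph post_scale^~ u : a b / a + b}.
Proof. by move=> a b; apply: hom_ext. Qed.

HB.instance Definition _ :=
  GRing.Zmodule_isLmodule.Build (endo V) (post_hom U V)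
    post_scaleA post_scale1 post_scaleDr post_scaleDl.

(** Value at [N] of the right adjoint of X |-> eX; [endo U] acts on the left because it acts on
    Hom(U, V) on the right. *)
Definition pre_hom (N : lmodType (endo V)) : Type :=
  hom (post_hom U V : lmodType (endo V)) N.

Section PreHom.
Variable N : lmodType (endo V).

HB.instance Definition _ := GRing.Zmodule.on (pre_hom N).

Definition precomp (s : endo U) (u : post_hom U V) : post_hom U V :=
  ((u : {linear U -> V}) \o (s : {linear U -> U}) : {linear U -> V}).

Lemma precomp_linear s : linear (precomp s).
Proof. by move=> a u v; apply: hom_ext. Qed.

HB.instance Definition _ s :=
  GRing.isLinear.Build (endo V) (post_hom U V) (post_hom U V) *:%R
    (precomp s) (precomp_linear s).

Definition pre_scale (s : endo U) (phi : pre_hom N) : pre_hom N :=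
  ((phi : {linear post_hom U V -> N}) \o precomp s : {linear post_hom U V -> N}).

Lemma pre_scaleA s t phi : pre_scale s (pre_scale t phi) = pre_scale (s * t) phi.
Proof.
apply: hom_ext => u /=; congr ((phi : {linear _ -> _}) _); exact: hom_ext.
Qed.

Lemma pre_scale1 : left_id 1 pre_scale.
Proof.
move=> phi; apply: hom_ext => u /=.
congr ((phi : {linear _ -> _}) _); exact: hom_ext.
Qed.

Lemma pre_scaleDr : right_distributive pre_scale +%R.
Proof. by move=> s phi psi; apply: hom_ext. Qed.

Lemma pre_scaleDl phi : {morph pre_scale^~ phi : s t / s + t}.
Proof.
move=> s t; apply: hom_ext => u /=; rewrite -linearD.
congr ((phi : {linear _ -> _}) _).
by apply: hom_ext => x /=; rewrite linearD.
Qed.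

HB.instance Definition _ :=
  GRing.Zmodule_isLmodule.Build (endo U) (pre_hom N)
    pre_scaleA pre_scale1 pre_scaleDr pre_scaleDl.

End PreHom.
End PostHom.

(** * The idempotent e = inj \o proj and the functor X |-> eX *)

Section Corner.
Variables (R : pzRingType) (U V : lmodType R).
Variables (inj : {linear V -> U}) (proj : {linear U -> V}).
Hypothesis injK : cancel inj proj.

Local Notation A := (endo V).
Local Notation E := (endo U).
Local Notation P := (post_hom U V).

(** Identifies [P] with the right ideal eE, with inverse s |-> proj \o s. *)
Definition lift_post (u : P) : E :=
  (inj \o (u : {linear U -> V}) : {linear U -> U}).
Definition proj_post : P := (proj : {linear U -> V}).
Definition corner_id : E := lift_post proj_post.
Definition corner_emb (a : A) : E := lift_post (a *: proj_post).

Lemma lift_postD u v : lift_post (u + v) = lift_post u + lift_post v.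
Proof. by apply: hom_ext => x /=; rewrite linearD. Qed.

Lemma lift_postM u s : lift_post u * s = lift_post (precomp s u).
Proof. exact: hom_ext. Qed.

Lemma corner_idM u : corner_id * lift_post u = lift_post u.
Proof. by apply: hom_ext => x /=; rewrite injK. Qed.

Lemma corner_embM a u : corner_emb a * lift_post u = lift_post (a *: u).
Proof. by apply: hom_ext => x /=; rewrite injK. Qed.

Section CornerObject.
Variable X : lmodType E.

(** As e is idempotent, eX is its set of fixed points; cut out by an equation, it becomes a
    subtype. *)
Definition in_corner : {pred X} := fun x => corner_id *: x == x.

Lemma in_cornerE x : (x \in in_corner) = (corner_id *: x == x).
Proof. by []. Qed.

Lemma in_corner_zmod_closed : zmod_closed in_corner.
Proof.
split=> [|x y]; rewrite !in_cornerE ?scaler0 // => /eqP ex /eqP ey.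
by rewrite scalerBr ex ey.
Qed.
HB.instance Definition _ :=
  GRing.isZmodClosed.Build X in_corner in_corner_zmod_closed.

Definition corner : Type := {x : X | x \in in_corner}.
HB.instance Definition _ := SubType.on corner.
HB.instance Definition _ := Choice.on corner.
HB.instance Definition _ := [SubChoice_isSubZmodule of corner by <:].

Lemma corner_val (x : corner) : corner_id *: val x = val x.
Proof. exact/eqP/(valP x). Qed.

Lemma lift_scale_in (u : P) (x : X) : lift_post u *: x \in in_corner.
Proof. by rewrite in_cornerE scalerA corner_idM. Qed.

(** The multiplication eE x X -> eX; with [x] fixed it gives the unit X -> Hom_A(P, eX) of the
    adjunction. *)
Definition corner_mk (u : P) (x : X) : corner :=
  Sub (lift_post u *: x) (lift_scale_in u x).

Definition corner_scale (a : A) (x : corner) : corner :=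
  corner_mk (a *: proj_post) (val x).

Lemma corner_scaleA a b x :
  corner_scale a (corner_scale b x) = corner_scale (a * b) x.
Proof.
by apply: val_inj => /=; rewrite scalerA corner_embM scalerA.
Qed.

Lemma corner_scale1 : left_id 1 corner_scale.
Proof. by move=> x; apply: val_inj; rewrite /= scale1r corner_val. Qed.

Lemma corner_scaleDr : right_distributive corner_scale +%R.
Proof. by move=> a x y; apply: val_inj; rewrite /= scalerDr. Qed.

Lemma corner_scaleDl x : {morph corner_scale^~ x : a b / a + b}.
Proof.
by move=> a b; apply: val_inj; rewrite /= scalerDl lift_postD scalerDl.
Qed.

HB.instance Definition _ :=
  GRing.Zmodule_isLmodule.Build A corner
    corner_scaleA corner_scale1 corner_scaleDr corner_scaleDl.

Lemma val_cornerZ (a : A) (x : corner) : val (a *: x) = corner_emb a *: val x.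
Proof. by []. Qed.

Lemma val_cornerD (x y : corner) : val (x + y) = val x + val y.
Proof. by []. Qed.

Lemma corner_eq0 (x : corner) : x = 0 <-> val x = 0.
Proof.
split=> [->|x0]; first exact: (raddf0 val).
by apply: val_inj; rewrite x0 (raddf0 val).
Qed.

Lemma corner_mk_linear (x : X) : linear (corner_mk^~ x).
Proof.
move=> a u v; apply: val_inj => /=.
by rewrite lift_postD scalerDl -(corner_embM a u) -scalerA.
Qed.

Lemma corner_mkK (x : corner) : corner_mk proj_post (val x) = x.
Proof. by apply: val_inj; rewrite /= corner_val. Qed.

End CornerObject.

Arguments in_corner : clear implicits.

Section CornerMap.
Variables (X Y : lmodType E) (f : {linear X -> Y}).

Lemma corner_map_in (x : corner X) : f (val x) \in in_corner Y.
Proof. by rewrite in_cornerE -linearZ /= corner_val. Qed.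

Definition corner_map (x : corner X) : corner Y :=
  Sub (f (val x)) (corner_map_in x).

Lemma corner_map_linear : linear corner_map.
Proof.
by move=> a x y; apply: val_inj; rewrite /= linearD linearZ.
Qed.

HB.instance Definition _ :=
  GRing.isLinear.Build A (corner X) (corner Y) *:%R
    corner_map corner_map_linear.

(** Source of the exactness of X |-> eX: if f x lies in eY, then e x is a preimage of it in eX. *)
Lemma corner_map_im (y : corner Y) x : f x = val y -> exists x', corner_map x' = y.
Proof.
move=> fx; exists (corner_mk proj_post x); apply: val_inj.
by rewrite /= linearZ_LR fx; exact: corner_val.
Qed.

End CornerMap.

Section CornerProjective.
Hypothesis projP : projective (P : lmodType A).
Variable Q : lmodType E.
Hypothesis projQ : projective Q.

(** A lifting problem for eQ over [g] transposes to one for [Q] over Hom_A(P, g), which is onto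
    because [P] is projective. Transposing the solution back is evaluation at [proj_post]. *)
Lemma corner_projective : projective (corner Q : lmodType A).
Proof.
move=> N N' g f g_surj.
have [g' g'E] : exists g' : {linear pre_hom U N -> pre_hom U N'},
    forall (phi : pre_hom U N) (u : P),
      (g' phi : {linear P -> N'}) u = g ((phi : {linear P -> N}) u).
  pose F (phi : pre_hom U N) : pre_hom U N' :=
    (g \o (phi : {linear P -> N}) : {linear P -> N'}).
  have F_lin : linear F.
    by move=> s phi psi; apply: hom_ext => u /=; rewrite linearD.
  by exists (to_linear F_lin).
(* The transpose of [f] under the adjunction. *)
have [f' f'E] : exists f' : {linear Q -> pre_hom U N'},
    forall q (u : P), (f' q : {linear P -> N'}) u = f (corner_mk u q).
  pose mk q : {linear P -> corner Q} := to_linear (corner_mk_linear q).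
  pose F q : pre_hom U N' := (f \o mk q : {linear P -> N'}).
  have F_lin : linear F.
    move=> s x y; apply: hom_ext => u /=; rewrite -linearD; congr (f _).
    by apply: val_inj; rewrite /= scalerDr scalerA lift_postM.
  by exists (to_linear F_lin).
have g'_surj phi' : exists phi, g' phi = phi'.
  have [phi phiE] := projP (phi' : {linear P -> N'}) g_surj.
  by exists (phi : pre_hom U N); apply: hom_ext => u; rewrite g'E phiE.
have [h hE] := projQ f' g'_surj.
pose F (x : corner Q) : N := (h (val x) : {linear P -> N}) proj_post.
have F_lin : linear F.
  move=> a x y; rewrite /F val_cornerD val_cornerZ linearD linearZ /=.
  congr (_ + _).
  (* Since proj \o inj = 1, precomposing [proj_post] with [corner_emb a] gives [a *: proj_post]. *)
  rewrite -linearZ_LR; congr ((h _ : {linear P -> N}) _).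
  by apply: hom_ext => z /=; rewrite injK.
exists (to_linear F_lin) => x /=.
by rewrite /F -g'E hE f'E corner_mkK.
Qed.

End CornerProjective.

(** Evaluation at [proj_post] is the counit: a phi fixed by e satisfies phi u = phi (u \o e) = (u \o
    inj) *: phi proj, so it is determined by its value at [proj_post]. *)
Lemma corner_pre_hom (N : lmodType A) :
  exists2 psi : {linear corner (pre_hom U N) -> N},
    injective psi & forall y, exists x, psi x = y.
Proof.
pose F (x : corner (pre_hom U N)) : N := (val x : {linear P -> N}) proj_post.
have F_lin : linear F.
  move=> a x y; rewrite /F val_cornerD val_cornerZ /=; congr (_ + _).
  rewrite -linearZ_LR; congr ((val x : {linear P -> N}) _).
  by apply: hom_ext => z /=; rewrite injK.
exists (to_linear F_lin) => [x y|n] /=.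
  rewrite /F => xy; apply: val_inj; apply: hom_ext => u.
  rewrite -(corner_val x) -(corner_val y) /=.
  pose a : A := ((u : {linear U -> V}) \o inj : {linear V -> V}).
  have -> : precomp corner_id u = a *: proj_post by apply: hom_ext.
  by rewrite !linearZ_LR /= xy.
(* The formula behind injectivity, read as a definition, gives the preimage of [n]. *)
pose G (u : P) : N :=
  (((u : {linear U -> V}) \o inj : {linear V -> V}) : A) *: n.
have G_lin : linear G.
  move=> a u v; rewrite /G scalerA -scalerDl; congr (_ *: _).
  exact: hom_ext.
pose phi : pre_hom U N := to_linear G_lin.
have phi_in : phi \in in_corner (pre_hom U N).
  rewrite in_cornerE; apply/eqP; apply: hom_ext => u /=; rewrite /G.
  by congr (_ *: _); apply: hom_ext => z /=; rewrite injK.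
exists (Sub phi phi_in); rewrite /F /= /G -[RHS]scale1r; congr (_ *: _).
by apply: hom_ext => z /=; rewrite injK.
Qed.

(** Exactness comes from [corner_map_im]; [psi] turns the augmentation onto e Hom_A(P, N) into one
    onto [N]. *)
Lemma corner_projdim (N : lmodType A) (n : nat) :
  projective (P : lmodType A) ->
  projdim_le (pre_hom U N : lmodType E) n -> projdim_le N n.
Proof.
move=> projP [Q [d [e [projQ e_surj e_ker d_ker Q0]]]].
have [psi psi_inj psi_surj] := corner_pre_hom N.
exists (fun i => corner (Q i) : lmodType A), (fun i => corner_map (d i)),
  (psi \o corner_map e); split.
- by move=> i; apply: corner_projective.
- move=> y; have [x <-] := psi_surj y; have [q eq] := e_surj (val x).
  by have [q' <-] := corner_map_im eq; exists q'.
- move=> x; split=> [/= ex0|[z <-]].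
    have /corner_eq0/= /e_ker[z dz] : corner_map e x = 0.
      by apply: psi_inj; rewrite ex0 linear0.
    exact: corner_map_im dz.
  rewrite /= (_ : corner_map e _ = 0) ?linear0 //; apply/corner_eq0 => /=.
  by apply/e_ker; exists (val z).
- move=> i x; split=> [/corner_eq0/= /d_ker[z dz]|[z <-]].
    exact: corner_map_im dz.
  by apply/corner_eq0/d_ker; exists (val z).
- by move=> i lt_ni x; apply/corner_eq0/(Q0 i lt_ni).
Qed.

Lemma corner_finite_gldim :
  projective (P : lmodType A) -> finite_gldim E -> finite_gldim A.
Proof.
move=> projP [n gldimE]; exists n => N.
exact: corner_projdim projP (gldimE _).
Qed.

End Corner.

(** * Linear maps out of an ideal of grade at least 2 *)

Section IdealHom.
Variables (R : comPzRingType) (I : ideal R).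

Definition ideal_mul (M : lmodType R) (m : M) (i : submod I) : M :=
  (val i : R) *: m.

Lemma ideal_mul_linear (M : lmodType R) (m : M) : linear (ideal_mul m).
Proof. by move=> a i j; rewrite /ideal_mul /= scalerDl scalerA. Qed.

HB.instance Definition _ (M : lmodType R) (m : M) :=
  GRing.isLinear.Build R (submod I) M *:%R (ideal_mul m) (ideal_mul_linear m).

(** Both sides are phi (i j). *)
Lemma val_idealC (M : lmodType R)
    (phi : {linear submod I -> M}) (i j : submod I) :
  (val i : R) *: phi j = (val j : R) *: phi i.
Proof.
rewrite -!linearZ_LR; congr (phi _); apply: val_inj => /=; exact: mulrC.
Qed.

Hypothesis I_grade : grade_ge I 2.

(** The unit ideal has infinite grade by convention and may contain no regular pair, hence the
    separate case. *)
Lemma grade2_regular_pair :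
  (1 : R) \in I \/
  exists x y : R, [/\ x \in I, y \in I, forall z, x * z = 0 -> z = 0
    & forall z c, y * z = c * x -> exists d, z = d * x].
Proof.
case: I_grade => [|[s [s2 sI [reg _]]]]; [by left | right].
case: s s2 sI reg => [|x [|y []]] // _ sI reg; exists x, y.
split=> [||z xz0|z c yz]; rewrite ?sI ?inE ?eqxx ?orbT //.
  (* The prefix of length 0 spans the zero ideal. *)
  have [|c] := reg 0 z isT; last by rewrite big_ord0.
  by exists (fun=> 0); rewrite big_ord0.
have [|d] := reg 1 z isT; last by rewrite big_ord1; exists (d 0).
by exists (fun=> c); rewrite big_ord1.
Qed.

Lemma grade2_annihilator (r : R) :
  (forall i : submod I, (val i : R) * r = 0) -> r = 0.
Proof.
move=> Ir0; have xr0 (x : R) (xI : x \in I) : x * r = 0.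
  exact: (Ir0 (Sub (x : R^o) xI)).
have [I1|[x [_ [xI _ x_reg _]]]] := grade2_regular_pair.
  by rewrite -(mul1r r) xr0.
by apply: x_reg; exact: xr0.
Qed.

(** With x, y regular, y phi(x) = x phi(y) forces phi(x) = c x; then x phi(i) = i phi(x) = x c i,
    and x cancels. *)
Lemma grade2_dual (phi : {linear submod I -> R^o}) :
  exists r : R, forall i, phi i = (val i : R) * r.
Proof.
have [I1|[x [y [xI yI x_reg y_reg]]]] := grade2_regular_pair.
  exists (phi (Sub (1 : R^o) I1)) => i.
  by have := val_idealC phi i (Sub (1 : R^o) I1); rewrite /= scale1r => <-.
pose i_x : submod I := Sub (x : R^o) xI.
pose i_y : submod I := Sub (y : R^o) yI.
have [|c phix] := y_reg (phi i_x) (phi i_y).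
  by rewrite [RHS]mulrC; exact: (val_idealC phi i_y i_x).
exists c => i; apply/eqP; rewrite -subr_eq0; apply/eqP/x_reg.
rewrite mulrBr; apply/eqP; rewrite subr_eq0; apply/eqP.
by apply: etrans (val_idealC phi i_x i) _; rewrite phix [RHS]mulrC -[RHS]mulrA.
Qed.

Section Reflexive.
Variable M : lmodType R.
Hypothesis M_refl : reflexive_module M.

Lemma reflexive_separated (m m' : M) :
  (forall f : {linear M -> R^o}, f m = f m') -> m = m'.
Proof.
move=> ff; apply: (bij_inj M_refl); apply: hom_ext => f; exact: ff.
Qed.

(** Functionals separate the points of the reflexive [M], which reduces the claim to
    [grade2_annihilator] in R. *)
Lemma ideal_mul_inj (m m' : M) :
  (forall i, ideal_mul m i = ideal_mul m' i) -> m = m'.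
Proof.
move=> mm'; apply: reflexive_separated => f.
apply/eqP; rewrite -subr_eq0; apply/eqP/grade2_annihilator => i.
rewrite mulrBr; apply/eqP; rewrite subr_eq0; apply/eqP.
have := congr1 f (mm' i); rewrite /ideal_mul !linearZ_LR; exact.
Qed.

(* For f in M^*, the map f \o phi : I -> R is multiplication by some r f; the
   assignment f |-> r f is linear, hence evaluation at an element of M. *)
Lemma ideal_mul_surj (phi : {linear submod I -> M}) :
  exists m, forall i, phi i = ideal_mul m i.
Proof.
have /choice[r rE] (f : dual M) : exists r : R^o, forall i,
    (f : {linear M -> R^o}) (phi i) = (val i : R) * r.
  pose f_phi : {linear submod I -> R^o} := (f : {linear M -> R^o}) \o phi.
  exact: (grade2_dual f_phi).
have r_lin : linear r.
  (* An element of R is determined by its multiples by elements of [I]. *)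
  move=> a f g; apply/eqP; rewrite -subr_eq0; apply/eqP/grade2_annihilator => i.
  apply/eqP; rewrite mulrBr subr_eq0 -rE mulrDr -rE /= rE.
  by apply/eqP; congr (_ + _); rewrite rE; exact: mulrCA.
have [ev_inv _ ev_invK] := M_refl.
exists (ev_inv (to_linear r_lin : dual (dual M))) => i.
apply: reflexive_separated => f; rewrite linearZ_LR rE.
congr (_ * _).
exact: (congr1 (fun h : dual (dual M) => (h : {linear dual M -> R^o}) f)
  (esym (ev_invK (to_linear r_lin)))).
Qed.

(** * Projectivity of Hom(M + I, M) over End(M) *)

Local Notation MI := (M * submod I)%type.
Local Notation P := (post_hom MI M).

(* Every u in P decomposes as u_1 *: u_M + to_endo (c u) *: u_I, where c u in M is
   the element multiplication by which is the restriction of u to I. *)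
Lemma post_hom_projective : has_ring_summand M ->
  projective (P : lmodType (endo M)).
Proof.
move=> [K [s [s' sK s'K]]] N N' g f g_surj.
(* The generator of the summand R; [to_endo m] will be an endomorphism sending [m0] to [m]. *)
pose m0 : M := s' (1, 0).
pose fst_s (x : M) : R^o := (s x).1.
have fst_s_m0 : fst_s m0 = 1 by rewrite /fst_s s'K.
have to_endo_lin (m : M) : linear (fun x : M => (fst_s x : R) *: m).
  by move=> a x y; rewrite /fst_s linearD linearZ_LR /= scalerDl scalerA.
pose to_endo m : endo M := to_linear (to_endo_lin m).
have u_1_lin (u : P) : linear (fun x : M => (u : {linear MI -> M}) (x, 0)).
  move=> a x y; rewrite -linearZ_LR -linearD.
  by congr ((u : {linear MI -> M}) _); congr (_, _); rewrite /= scaler0 addr0.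
pose restr (u : P) i := (u : {linear MI -> M}) (0, i).
have restr_lin u : linear (restr u).
  move=> a i j; rewrite /restr -linearZ_LR -linearD.
  by congr ((u : {linear MI -> M}) _); congr (_, _); rewrite /= scaler0 addr0.
have /choice[c cE] u := ideal_mul_surj (to_linear (restr_lin u)).
(* By uniqueness of the multiplier, [c] inherits linearity from restriction to [I]. *)
have c_lin a (u v : P) : c (a *: u + v) = (a : {linear M -> M}) (c u) + c v.
  apply: ideal_mul_inj => i; rewrite -cE /ideal_mul scalerDr -linearZ_LR.
  by rewrite -/(ideal_mul (c u) i) -/(ideal_mul (c v) i) -!cE.
pose u_M : P := (fst : {linear MI -> M}).
pose u_I : P := (ideal_mul m0 \o snd : {linear MI -> M}).
have [n_M n_ME] := g_surj (f u_M); have [n_I n_IE] := g_surj (f u_I).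
pose u_1 (u : P) : endo M := to_linear (u_1_lin u).
(* Lifting the images of [u_M] and [u_I] suffices, since the two coefficients of [u] are
   [endo M]-linear in [u]: [P] is a summand of a free module of rank 2. *)
pose F u : N := u_1 u *: n_M + to_endo (c u) *: n_I.
have F_lin : linear F.
  move=> a u v; rewrite /F scalerDr !scalerA addrACA -!scalerDl.
  congr (_ *: _ + _ *: _); apply: hom_ext => x //=.
  by rewrite c_lin scalerDr linearZ_LR.
exists (to_linear F_lin) => u /=.
rewrite /F linearD !linearZ_LR n_ME n_IE -!linearZ_LR -linearD; congr (f _).
apply: hom_ext => -[x i] /=; rewrite /ideal_mul.
have -> : fst_s ((val i : R) *: m0) = val i.
  by rewrite /fst_s linearZ_LR /= -/(fst_s m0) fst_s_m0 [LHS]mulr1.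
rewrite -/(ideal_mul (c u) i) -cE /= /restr -linearD.
by congr ((u : {linear MI -> M}) _); congr (_, _); rewrite ?addr0 ?add0r.
Qed.

End Reflexive.
End IdealHom.

Theorem theorem5p1 (R : comPzRingType) (I : ideal R) (M : lmodType R) :
  quasi_normal R ->
  grade_ge I 2 ->
  fin_gen M ->
  reflexive_module M ->
  has_ring_summand M ->
  finite_gldim (endo (M * submod I)%type) ->
  finite_gldim (endo M).
Proof.
move=> _ I_grade _ M_refl M_summand.
have inj_lin : linear (fun m : M => (m, 0) : (M * submod I)%type).
  by move=> a x y; congr (_, _); rewrite /= scaler0 addr0.
apply: (@corner_finite_gldim _ _ _ (to_linear inj_lin) fst) => //.
exact: post_hom_projective.
Qed.
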